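(* The Set-Fmla logic $\mathcal{PP}^{\Rightarrow_H}_{\le}$ is not determined by any single logical matrix. The same holds for the Set-Set logics $\mathcal{PP}^{\rhd,\Rightarrow_H}_{\le}$ and $\mathcal{PP}^{\rhd,\Rightarrow_H}_{\mathsf{up}}$.
   Context: Let $\mathcal{V}_6=\{\hat{\mathbf f},\mathbf f,\mathbf n,\mathbf b,\mathbf t,\hat{\mathbf t}\}$, partially ordered as a bounded distributive lattice by $\hat{\mathbf f}<\mathbf f<\mathbf n<\mathbf t<\hat{\mathbf t}$ and $\mathbf f<\mathbf b<\mathbf t$, with $\mathbf n,\mathbf b$ incomparable. $\mathbf{PP}_6$ is the algebra on $\mathcal V_6$ in the signature $\{\land,\lor,{\sim},\circ,\bot,\top\}$ where $\land,\lor$ are meet and join, $\bot=\hat{\mathbf f}$, $\top=\hat{\mathbf t}$, ${\sim}$ swaps $\mathbf f\leftrightarrow\mathbf t$ and $\hat{\mathbf f}\leftrightarrow\hat{\mathbf t}$ and fixes $\mathbf n,\mathbf b$, and ${\circ}a=\hat{\mathbf t}$ if $a\in\{\hat{\mathbf f},\hat{\mathbf t}\}$, ${\circ}a=\hat{\mathbf f}$ otherwise. $\mathbf{PP}_6^{\Rightarrow_H}$ expands $\mathbf{PP}_6$ by $a\Rightarrow b=\max\{c: a\land c\le b\}$. ${\uparrow}a=\{c: a\le c\}$. Logic of matrices: a (logical) matrix is $\langle\mathbf A,D\rangle$ with $\mathbf A$ an algebra of the signature and $D\subseteq A$; the Set-Set logic determined by a class $\mathcal M$ of matrices is: $\Phi\rhd\Psi$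 iff for every $\langle\mathbf A,D\rangle\in\mathcal M$ and homomorphism $h$ from formulas to $\mathbf A$, $h(\varphi)\notin D$ for some $\varphi\in\Phi$ or $h(\psi)\in D$ for some $\psi\in\Psi$; the Set-Fmla one: $\Phi\vdash\psi$ iff $\Phi\rhd\{\psi\}$. $\Phi\rhd^{\le}_{\mathsf K}\Psi$ iff for some finite $\Phi'\subseteq\Phi,\Psi'\subseteq\Psi$, $\bigwedge\Phi'\le\bigvee\Psi'$ is valid in $\mathsf K$ ($\bigwedge\varnothing=\top$, $\bigvee\varnothing=\bot$); $\mathcal{PP}^{\rhd,\Rightarrow_H}_{\le}$ is this logic for $\mathsf K=\mathbb V(\mathbf{PP}_6^{\Rightarrow_H})$ and $\mathcal{PP}^{\Rightarrow_H}_{\le}$ its Set-Fmla companion ($\Phi\vdash\psi$ iff $\Phi\rhd\{\psi\}$). $\mathcal{PP}^{\rhd,\Rightarrow_H}_{\mathsf{up}}$ is the Set-Set logic determined by the class $\{\langle\mathbf{PP}_6^{\Rightarrow_H},{\uparrow}a\rangle: a\in\mathcal V_6\}$. *)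

(* Defs.v *)
From Stdlib Require List.
From HB Require Import structures.
From mathcomp Require Import all_boot all_order.
From mathcomp Require Import classical_sets.

Set Implicit Arguments.
Unset Strict Implicit.
Unset Printing Implicit Defensive.

Import Order.TTheory.
Local Open Scope order_scope.
Local Open Scope classical_set_scope.

Record algebra : Type := Algebra {
  carrier :> Type;
  op_and : carrier -> carrier -> carrier;
  op_or : carrier -> carrier -> carrier;
  op_imp : carrier -> carrier -> carrier;
  op_neg : carrier -> carrier;
  op_circ : carrier -> carrier;
  op_bot : carrier;
  op_top : carrier }.

Record is_hom (A B : algebra) (h : A -> B) : Prop := IsHom {
  hom_and : forall x y, h (op_and x y) = op_and (h x) (h y);
  hom_or : forall x y, h (op_or x y) = op_or (h x) (h y);
  hom_imp : forall x y, h (op_imp x y) = op_imp (h x) (h y);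
  hom_neg : forall x, h (op_neg x) = op_neg (h x);
  hom_circ : forall x, h (op_circ x) = op_circ (h x);
  hom_bot : h (op_bot A) = op_bot B;
  hom_top : h (op_top A) = op_top B }.

Definition prod_algebra (I : Type) (A : I -> algebra) : algebra :=
  @Algebra (forall i, A i)
    (fun x y i => op_and (x i) (y i))
    (fun x y i => op_or (x i) (y i))
    (fun x y i => op_imp (x i) (y i))
    (fun x i => op_neg (x i))
    (fun x i => op_circ (x i))
    (fun i => op_bot (A i))
    (fun i => op_top (A i)).

(* The least class containing K and closed under homomorphic images,
   subalgebras (up to isomorphism) and arbitrary products. *)
Inductive variety (K : set algebra) : algebra -> Prop :=
| variety_gen (A : algebra) : K A -> variety K A
| variety_hom (A B : algebra) (h : A -> B) :
    variety K A -> is_hom h -> (forall y, exists x, h x = y) -> variety K B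
| variety_sub (A B : algebra) (h : B -> A) :
    variety K A -> is_hom h -> injective h -> variety K B
| variety_prod (I : Type) (A : I -> algebra) :
    (forall i, variety K (A i)) -> variety K (prod_algebra A).

Inductive form : Type :=
| Var of nat
| And of form & form
| Or of form & form
| Imp of form & form
| Neg of form
| Circ of form
| Bot
| Top.

Definition form_algebra : algebra := Algebra And Or Imp Neg Circ Bot Top.

Definition logic_ss := set form -> set form -> Prop.
Definition logic_sf := set form -> form -> Prop.

Definition companion (L : logic_ss) : logic_sf :=
  fun Phi psi => L Phi [set psi].

Record lmatrix : Type := LMatrix {
  mx_alg : algebra;
  mx_des : set mx_alg }.

Definition matrices_logic (C : set lmatrix) : logic_ss := fun Phi Psi =>
  forall M, C M -> forall h : form_algebra -> mx_alg M, is_hom h ->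
    (exists2 phi, Phi phi & ~ mx_des (h phi)) \/
    (exists2 psi, Psi psi & mx_des (h psi)).

Definition determined_ss (L : logic_ss) (M : lmatrix) : Prop :=
  forall Phi Psi, L Phi Psi <-> matrices_logic [set M] Phi Psi.

Definition determined_sf (L : logic_sf) (M : lmatrix) : Prop :=
  forall Phi psi, L Phi psi <-> companion (matrices_logic [set M]) Phi psi.

Definition valid_le (K : set algebra) (phi psi : form) : Prop :=
  forall A, K A -> forall h : form_algebra -> A, is_hom h ->
    op_and (h phi) (h psi) = h phi.

(* Finite subsets are given by lists of their elements. *)
Definition order_logic (K : set algebra) : logic_ss := fun Phi Psi =>
  exists s t : seq form,
    [/\ List.Forall Phi s, List.Forall Psi t &
        valid_le K (foldr And Top s) (foldr Or Bot t)].

(* Vhf and Vht are the hatted (bottom and top) values. *)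
Inductive V6 : Set := Vhf | Vf | Vn | Vb | Vt | Vht.

Definition V6_code (a : V6) : 'I_6 :=
  inord match a with
        | Vhf => 0 | Vf => 1 | Vn => 2 | Vb => 3 | Vt => 4 | Vht => 5
        end.
Definition V6_decode (i : 'I_6) : V6 := nth Vhf [:: Vhf; Vf; Vn; Vb; Vt; Vht] i.
Fact V6_codeK : cancel V6_code V6_decode.
Proof. by case; rewrite /V6_decode /V6_code inordK. Qed.

HB.instance Definition _ := Finite.copy V6 (can_type V6_codeK).

Definition V6_le (a b : V6) : bool :=
  match a, b with
  | Vhf, _ | _, Vht => true
  | Vf, (Vf | Vn | Vb | Vt) => true
  | Vn, (Vn | Vt) | Vb, (Vb | Vt) | Vt, Vt => true
  | _, _ => false
  end.

(* The only incomparable pair is Vn, Vb, with meet Vf and join Vt. *)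
Definition V6_meet (a b : V6) : V6 :=
  if V6_le a b then a else if V6_le b a then b else Vf.
Definition V6_join (a b : V6) : V6 :=
  if V6_le a b then b else if V6_le b a then a else Vt.

Fact V6_le_def a b : V6_le a b = (V6_meet a b == a).
Proof. by apply/idP/eqP; case: a; case: b. Qed.
Fact V6_meetC : commutative V6_meet. Proof. by do 2!case. Qed.
Fact V6_joinC : commutative V6_join. Proof. by do 2!case. Qed.
Fact V6_meetA : associative V6_meet. Proof. by do 3!case. Qed.
Fact V6_joinA : associative V6_join. Proof. by do 3!case. Qed.
Fact V6_joinKI b a : V6_meet a (V6_join a b) = a. Proof. by case: a; case: b. Qed.
Fact V6_meetKU b a : V6_join a (V6_meet a b) = a. Proof. by case: a; case: b. Qed.
Fact V6_meetUl : left_distributive V6_meet V6_join. Proof. by do 3!case. Qed.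

Fact V6_meetxx : idempotent_op V6_meet. Proof. by case. Qed.

Fact V6_display : Order.disp_t. Proof. exact: Order.Disp tt tt. Qed.

HB.instance Definition _ := Order.isMeetJoinDistrLattice.Build V6_display V6
  V6_le_def (fun _ _ => erefl) V6_meetC V6_joinC V6_meetA V6_joinA
  V6_joinKI V6_meetKU V6_meetUl V6_meetxx.

Fact V6_le0x a : Vhf <= a. Proof. by case: a. Qed.
Fact V6_lex1 a : a <= Vht. Proof. by case: a. Qed.

HB.instance Definition _ := Order.hasBottom.Build V6_display V6 V6_le0x.
HB.instance Definition _ := Order.hasTop.Build V6_display V6 V6_lex1.

Definition V6_neg (a : V6) : V6 :=
  match a with
  | Vhf => Vht | Vf => Vt | Vn => Vn | Vb => Vb | Vt => Vf | Vht => Vhf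
  end.

Definition V6_circ (a : V6) : V6 :=
  match a with Vhf | Vht => Vht | _ => Vhf end.

(* The maximum of {c | a `&` c <= b}; that this join is attained is V6_impP. *)
Definition V6_imp (a b : V6) : V6 := \join_(c : V6 | (a `&` c <= b)%O) c.

Lemma V6_impP (a b : V6) :
  (a `&` V6_imp a b <= b)%O /\
  forall c : V6, (a `&` c <= b)%O -> c <= V6_imp a b.
Proof.
split=> [|c ac_le_b]; last exact: joins_sup.
rewrite /V6_imp; apply: (big_ind (fun c : V6 => (a `&` c <= b)%O)) => // [|x y].
  by rewrite meetx0 le0x.
by rewrite meetUr leUx => -> ->.
Qed.

Definition PP6H : algebra :=
  @Algebra V6 Order.meet Order.join V6_imp V6_neg V6_circ \bot \top.

Definition PP_le_ss : logic_ss := order_logic (variety [set PP6H]).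

Definition PP_le_sf : logic_sf := companion PP_le_ss.

Definition PP_up_ss : logic_ss :=
  matrices_logic
    (range (fun a : V6 => @LMatrix PP6H [set c : V6 | a <= c])).

(* Main.v *)
From Stdlib Require List.
From mathcomp Require Import all_boot all_order.
From mathcomp Require Import boolp classical_sets.
Require Import Defs.

Set Implicit Arguments.
Unset Strict Implicit.
Unset Printing Implicit Defensive.

Import Order.TTheory.
Local Open Scope order_scope.
Local Open Scope classical_set_scope.

(** The logic of a single matrix has the cancellation property: if [phi] entails
    [psi] and they share no variable, then either [psi] is a theorem or [phi]
    entails everything, because a valuation refuting [psi] and one designating
    [phi] can be glued together.  The three logics violate cancellation.  Let
    [phi] be [x /\ ~x] and [psi] the prelinearity formula
    [(y => z) \/ (z => y)].  In [PP6H] every value of [phi] is below t and every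
    value of [psi] is above t, so [phi] entails [psi]; but [psi] takes the value
    t at (n, b), so it is not a theorem, and [phi] takes the value n at n, so it
    does not entail a fresh variable. *)

Fixpoint eval (A : algebra) (v : nat -> A) (phi : form) : A :=
  match phi with
  | Var n => v n
  | And f g => op_and (eval v f) (eval v g)
  | Or f g => op_or (eval v f) (eval v g)
  | Imp f g => op_imp (eval v f) (eval v g)
  | Neg f => op_neg (eval v f)
  | Circ f => op_circ (eval v f)
  | Bot => op_bot A
  | Top => op_top A
  end.

Lemma eval_hom (A : algebra) (v : nat -> A) :
  @is_hom form_algebra A (eval v).
Proof. by split. Qed.

Lemma hom_eval (A B : algebra) (h : A -> B) (v : nat -> A) phi :
  is_hom h -> h (eval v phi) = eval (h \o v) phi.
Proof.
case=> hand hor himp hneg hcirc hbot htop.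
elim: phi => //= [f IHf g IHg|f IHf g IHg|f IHf g IHg|f IHf|f IHf].
- by rewrite hand IHf IHg.
- by rewrite hor IHf IHg.
- by rewrite himp IHf IHg.
- by rewrite hneg IHf.
- by rewrite hcirc IHf.
Qed.

Lemma eval_Var phi : eval (A := form_algebra) Var phi = phi.
Proof. by elim: phi => //= [f -> g ->|f -> g ->|f -> g ->|f ->|f ->]. Qed.

(** Formulas are freely generated by the variables, so homomorphisms out of them can be traded for
    valuations. *)
Lemma form_homE (A : algebra) (h : form_algebra -> A) phi :
  is_hom h -> h phi = eval (h \o Var) phi.
Proof. by move=> hh; rewrite -(@hom_eval form_algebra A h Var phi hh) eval_Var. Qed.

Fixpoint vars (phi : form) : seq nat :=
  match phi with
  | Var n => [:: n]
  | And f g | Or f g | Imp f g => vars f ++ vars g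
  | Neg f | Circ f => vars f
  | Bot | Top => [::]
  end.

Lemma eq_in_eval (A : algebra) (v w : nat -> A) phi :
  {in vars phi, v =1 w} -> eval v phi = eval w phi.
Proof.
elim: phi => //= [n|f IHf g IHg|f IHf g IHg|f IHf g IHg|f IHf|f IHf] vw.
- by apply: vw; rewrite inE.
- by rewrite IHf ?IHg // => n n_in; apply: vw; rewrite mem_cat n_in ?orbT.
- by rewrite IHf ?IHg // => n n_in; apply: vw; rewrite mem_cat n_in ?orbT.
- by rewrite IHf ?IHg // => n n_in; apply: vw; rewrite mem_cat n_in ?orbT.
- by rewrite IHf.
- by rewrite IHf.
Qed.

Lemma matrix_cancellation (M : lmatrix) (phi psi : form) (Psi : set form) :
    ~~ has (mem (vars phi)) (vars psi) ->
    companion (matrices_logic [set M]) [set phi] psi ->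
  companion (matrices_logic [set M]) set0 psi \/
  matrices_logic [set M] [set phi] Psi.
Proof.
move=> disj phi_psi.
(* If [phi] is satisfiable in [M], gluing makes [psi] a theorem; otherwise [phi] entails everything
   vacuously. *)
have [phi_des|phi_undes] := pselect (exists v, mx_des (@eval (mx_alg M) v phi)).
  left=> _ -> h hh; right; exists psi => //; rewrite (form_homE _ hh).
  have [v v_phi] := phi_des.
  pose w n := if n \in vars phi then v n else h (Var n).
  have w_phi : eval w phi = eval v phi.
    by apply: eq_in_eval => n n_in; rewrite /w n_in.
  have w_psi : eval w psi = eval (h \o Var) psi.
    apply: eq_in_eval => n n_in; rewrite /w ifN //.
    by apply: contra disj => n_phi; apply/hasP; exists n.
  have [[_ -> /=]|[_ ->]] := phi_psi M erefl _ (eval_hom w).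
    by rewrite w_phi.
  by rewrite w_psi.
right=> _ -> h hh; left; exists phi => // h_phi; apply: phi_undes.
by exists (h \o Var); rewrite -form_homE.
Qed.

Lemma not_determined_sf (L : logic_sf) (phi psi chi : form) :
    ~~ has (mem (vars phi)) (vars psi) ->
    L [set phi] psi -> ~ L set0 psi -> ~ L [set phi] chi ->
  ~ exists M : lmatrix, determined_sf L M.
Proof.
move=> disj phi_psi psiN phi_chiN [M LM].
by case: (matrix_cancellation [set chi] disj ((LM _ _).1 phi_psi)) => /LM.
Qed.

(** Reduces the Set-Set claims to their Set-Fmla companions. *)
Lemma determined_companion (L : logic_ss) (M : lmatrix) :
  determined_ss L M -> determined_sf (companion L) M.
Proof. by move=> LM Phi psi; apply: LM. Qed.

(** The easy half of Birkhoff's theorem: homomorphic images, subalgebras and products preserve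
    equations. *)
Lemma variety_valid_eq (K : set algebra) (phi psi : form) :
    (forall A, K A -> forall v : nat -> A, eval v phi = eval v psi) ->
  forall A, variety K A -> forall v : nat -> A, eval v phi = eval v psi.
Proof.
move=> K_eq A; elim=> {A} [|A B h _ IH hh h_surj v|A B h _ IH hh h_inj v|I A _ IH v].
- exact: K_eq.
(* A valuation in the image lifts along the surjection. *)
- have [u hu] := choice (fun n => h_surj (v n)).
  have -> : v = h \o u by apply: funext => n; rewrite /= hu.
  by rewrite -!hom_eval // IH.
- by apply: h_inj; rewrite !hom_eval.
- apply: functional_extensionality_dep => i.
  have proj_hom : @is_hom (prod_algebra A) (A i) (fun x => x i) by split.
  by rewrite !(hom_eval _ _ proj_hom).
Qed.

(** The inequality is itself an equation, [And phi psi] = [phi], so it passes from the generator to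
    the variety. *)
Lemma valid_le_variety (A : algebra) (phi psi : form) :
    (forall v : nat -> A, op_and (eval v phi) (eval v psi) = eval v phi) ->
  valid_le (variety [set A]) phi psi.
Proof.
move=> A_le B VB h hh; rewrite -(hom_and hh) !(form_homE _ hh).
by apply: (@variety_valid_eq [set A] (And phi psi) phi) => // _ ->.
Qed.

(** Principal up-sets are filters: they contain finite meets of their members and all that lies
    above. The inclusion moves entailments to the up-set logic and non-entailments back to the order
    logic. *)
Lemma PP_le_sf_sub_up (Phi : set form) (psi : form) :
  PP_le_sf Phi psi -> companion PP_up_ss Phi psi.
Proof.
move=> [s [t [sPhi tpsi s_le_t]]] _ [a _ <-] h hh.
have [Phi_des|] := pselect (forall phi, Phi phi -> a <= (h phi : V6)); last first.
  by move=> /existsNP[phi /not_implyP[]]; left; exists phi.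
right; exists psi => //=.
have a_le_s : a <= (h (foldr And Top s) : V6).
  elim: s sPhi {s_le_t} => [|phi s IHs] sPhi /=.
    by rewrite (hom_top hh) lex1.
  have [phi_in s_in] := (List.Forall_cons_iff Phi phi s).1 sPhi.
  by rewrite (hom_and hh) lexI Phi_des // IHs.
(* All entries of [t] equal [psi], and the empty join is the bottom. *)
have t_le_psi : (h (foldr Or Bot t) : V6) <= h psi.
  elim: t tpsi {s_le_t} => [|phi t IHt] tpsi /=.
    by rewrite (hom_bot hh) le0x.
  have [-> t_in] := (List.Forall_cons_iff [set psi] phi t).1 tpsi.
  by rewrite (hom_or hh) leUx lexx IHt.
apply: le_trans a_le_s (le_trans _ t_le_psi).
by rewrite leEmeet; apply/eqP/(s_le_t PP6H (variety_gen erefl) h hh).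
Qed.

Definition contradiction : form := And (Var 0) (Neg (Var 0)).

Definition prelinearity : form :=
  Or (Imp (Var 1) (Var 2)) (Imp (Var 2) (Var 1)).

Lemma V6_contradiction_le (a : V6) : (a `&` V6_neg a <= Vt)%O.
Proof. by case: a. Qed.

Lemma V6_imp_ge (a b : V6) : b <= V6_imp a b.
Proof. by apply: (V6_impP a b).2; rewrite leIr. Qed.

Lemma V6_imp_top (a b : V6) : a <= b -> V6_imp a b = Vht.
Proof.
move=> ab; apply/eqP; rewrite -[_ == _]/(_ == \top) -le1x.
by apply: (V6_impP a b).2; rewrite meetx1.
Qed.

(** For comparable arguments one implication is the top. Otherwise the arguments are n and b, each
    implication is above its consequent, and n, b join to t. *)
Lemma V6_prelinearity_ge (a b : V6) : (Vt <= V6_imp a b `|` V6_imp b a)%O.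
Proof.
have [ab|abN] := boolP (a <= b).
  by rewrite (V6_imp_top ab) (_ : Vht = \top) // join1x lex1.
have [ba|baN] := boolP (b <= a).
  by rewrite (V6_imp_top ba) (_ : Vht = \top) // joinx1 lex1.
apply: le_trans (leU2 (V6_imp_ge a b) (V6_imp_ge b a)).
by case: a abN baN; case: b.
Qed.

(** Only the top is not below t, and a top implication would make n and b comparable. *)
Lemma V6_prelinearity_nb : (V6_imp Vn Vb `|` V6_imp Vb Vn <= Vt)%O.
Proof.
rewrite leUx; have [+ _] := V6_impP Vn Vb; have [+ _] := V6_impP Vb Vn.
by case: (V6_imp Vn Vb) => //; case: (V6_imp Vb Vn).
Qed.

Lemma PP_le_ss_contradiction_prelinearity :
  PP_le_ss [set contradiction] [set prelinearity].
Proof.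
exists [:: contradiction], [:: prelinearity]; split; try by constructor.
(* Folding the singleton lists leaves a trailing [Top] in the meet and [Bot] in the join. *)
apply: valid_le_variety => v /=.
apply/meet_idPl; rewrite meetx1 joinx0.
exact: le_trans (V6_contradiction_le _) (V6_prelinearity_ge _ _).
Qed.

Lemma PP_up_ss_contradiction_prelinearity :
  PP_up_ss [set contradiction] [set prelinearity].
Proof. exact: PP_le_sf_sub_up PP_le_ss_contradiction_prelinearity. Qed.

Lemma PP_up_ss_prelinearityN : ~ PP_up_ss set0 [set prelinearity].
Proof.
(* With the top as only designated value, the value t at (n, b) is undesignated. *)
pose v n : PP6H := if n == 1 then Vn else Vb.
move=> /(_ _ (imageT _ Vht) _ (eval_hom v)) [[]//|[_ -> /=]].
by move=> /le_trans/(_ V6_prelinearity_nb).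
Qed.

Lemma PP_up_ss_contradictionN : ~ PP_up_ss [set contradiction] [set Var 1].
Proof.
(* Negation fixes n, so [contradiction] takes the value n and lies in the up-set of n, while [Var 1]
   is sent to the bottom. *)
pose v n : PP6H := if n == 0 then Vn else Vhf.
by move=> /(_ _ (imageT _ Vn) _ (eval_hom v)) [[_ -> /=]|[_ -> /=]].
Qed.

Theorem theorem5p7 :
  ~ (exists M : lmatrix, determined_sf PP_le_sf M) /\
  ~ (exists M : lmatrix, determined_ss PP_le_ss M) /\
  ~ (exists M : lmatrix, determined_ss PP_up_ss M).
Proof.
have le_sfN : ~ exists M, determined_sf PP_le_sf M.
  apply: (@not_determined_sf _ contradiction prelinearity (Var 1)) => //.
  - exact: PP_le_ss_contradiction_prelinearity.
  - by move=> /PP_le_sf_sub_up /PP_up_ss_prelinearityN.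
  - by move=> /PP_le_sf_sub_up /PP_up_ss_contradictionN.
have up_sfN : ~ exists M, determined_sf (companion PP_up_ss) M.
  apply: (@not_determined_sf _ contradiction prelinearity (Var 1)) => //.
  - exact: PP_up_ss_contradiction_prelinearity.
  - exact: PP_up_ss_prelinearityN.
  - exact: PP_up_ss_contradictionN.
split=> //; split=> -[M LM].
- by apply: le_sfN; exists M; apply: determined_companion LM.
- by apply: up_sfN; exists M; apply: determined_companion LM.
Qed.
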